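(* Let $s$ be a degree sequence and let $G,H\in\mathcal{P}(s)$. Then there exists a sequence of p-switches transforming $G$ into $H$; that is, there are 2-switches $\tau_1,\dots,\tau_k$ ($k\ge0$) such that, with $G_0=G$ and $G_i=\tau_i(G_{i-1})$, each $\tau_i$ is a p-switch over $G_{i-1}$ and $G_k=H$.
   Context: All graphs are finite, simple, undirected and labeled, with vertex set $[n]$. The degree sequence of a graph $G$ with $V(G)=[n]$ is $(d_1,\dots,d_n)$ where $d_i$ is the degree of vertex $i$. A pseudoforest is a graph each of whose connected components contains at most one cycle (i.e. each component is a tree or a unicyclic graph, a unicyclic graph being a connected graph with exactly one cycle). $\mathcal{P}(s)$ is the set of pseudoforests with degree sequence $s$. For $a,b,c,d\in[n]$, the matrix $A=\binom{a\ b}{c\ d}$ is interchangeable in $G$ if $ab,cd\in E(G)$, $\{a,b\}\cap\{c,d\}=\varnothing$ and $ac,bd\notin E(G)$. The 2-switch $\tau_A$ sends $G$ to $G-ab-cd+ac+bd$ if $A$ is interchangeable in $G$, and to $G$ otherwise (then $\tau_A$ is trivial for $G$). A nontrivial 2-switch $\tau$ over a pseudoforest $G$ is a p-switch if $\tau(G)$ is a pseudoforest. The empty sequence is allowed. *)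

(* Defs.v *)
From mathcomp Require Import all_boot.
Set Implicit Arguments. Unset Strict Implicit. Unset Printing Implicit Defensive.

Definition graph (n : nat) := {set {set 'I_n}}.

Definition simple_graph n (G : graph n) : Prop :=
  forall e, e \in G -> #|e| = 2.

Definition adj n (G : graph n) : rel 'I_n := fun u v => [set u; v] \in G.

Definition degree n (G : graph n) (v : 'I_n) : nat := #|[set e in G | v \in e]|.

Definition has_degseq n (G : graph n) (s : 'I_n -> nat) : Prop :=
  forall v, degree G v = s v.

(* A cycle of G: a nonempty set of edges of G forming a connected 2-regular
   subgraph (every vertex has degree 0 or 2 in F, and all vertices covered by
   F are connected using edges of F). *)
Definition is_cycle n (G : graph n) (F : graph n) : Prop :=
  [/\ F \subset G, F != set0,
      (forall v, degree F v = 0 \/ degree F v = 2) &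
      (forall u v, 0 < degree F u -> 0 < degree F v -> connect (adj F) u v)].

Definition pseudoforest n (G : graph n) : Prop :=
  forall F1 F2 u v, is_cycle G F1 -> is_cycle G F2 ->
    0 < degree F1 u -> 0 < degree F2 v -> connect (adj G) u v -> F1 = F2.

(* A 2-switch is given by the matrix A = (a b; c d), encoded as (a,b,c,d). *)
Definition sw n := ('I_n * 'I_n * 'I_n * 'I_n)%type.

Definition interchangeable n (A : sw n) (G : graph n) : Prop :=
  let: (a, b, c, d) := A in
  [/\ [set a; b] \in G, [set c; d] \in G,
      [disjoint [set a; b] & [set c; d]],
      [set a; c] \notin G & [set b; d] \notin G].

Definition tau n (A : sw n) (G : graph n) : graph n :=
  let: (a, b, c, d) := A in
  if [&& [set a; b] \in G, [set c; d] \in G,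
         [disjoint [set a; b] & [set c; d]],
         [set a; c] \notin G & [set b; d] \notin G]
  then ((G :\ [set a; b]) :\ [set c; d]) :|: [set [set a; c]; [set b; d]]
  else G.

Definition p_switch n (A : sw n) (G : graph n) : Prop :=
  interchangeable A G /\ pseudoforest (tau A G).

Fixpoint pswitch_chain n (G : graph n) (ts : seq (sw n)) (H : graph n) : Prop :=
  match ts with
  | [::] => G = H
  | t :: ts' => p_switch t G /\ pswitch_chain (tau t G) ts' H
  end.

(* Main.v *)
(* A simple graph is a pseudoforest iff it is sparse: every vertex set S spans at
   most |S| edges.  Induct on the degree sum.  If a leaf v hangs at y in G and at
   x in H with s y <= s x, one switch v-y, x-z to v-x, y-z in G re-hangs v at x,
   and a count of tight sets (|S| vertices spanning |S| edges) shows that z can be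
   chosen so that the result is still sparse; then delete v from both graphs.  If
   there is no leaf, sparsity forces all degrees into {0, 2}, so every realization
   is a pseudoforest, and the Havel-Hakimi argument for arbitrary graphs, which is
   the same re-hanging without the choice of z, connects G to H. *)

Require Import Defs.
From mathcomp Require Import all_boot zify.

Set Implicit Arguments. Unset Strict Implicit. Unset Printing Implicit Defensive.

(* The cardinals found by unification differ from the parsed ones by
   [reverse_coercion] marks, which [lia] would take for distinct atoms. *)
Ltac card_lia :=
  unfold reverse_coercion in *;
  repeat match goal with
  | H : is_true (leq _ _) |- _ => revert H
  | H : @eq nat _ _ |- _ => revert H
  end;
  repeat match goal with |- context [#|?A|] => generalize #|A|; intro end;
  clear; lia.

Section Graphs.

Variable n : nat.
Implicit Types (F G H X Y : graph n) (S T : {set 'I_n}) (e : {set 'I_n})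
  (a b c d u v w x y z p q : 'I_n).

(** * Edge sets: neighborhoods, degrees and the handshake identity *)

Definition simpleb G := [forall e in G, #|e| == 2].

Lemma simpleP G : reflect (simple_graph G) (simpleb G).
Proof. exact: 'forall_in_eqP. Qed.

Lemma simple_sub F G : F \subset G -> simpleb G -> simpleb F.
Proof. by move=> /subsetP sFG /forall_inP h; apply/forall_inP => e /sFG /h. Qed.

Lemma simpleU F G : simpleb F -> simpleb G -> simpleb (F :|: G).
Proof.
move=> /forall_inP hF /forall_inP hG; apply/forall_inP => e.
by rewrite inE => /orP[/hF|/hG].
Qed.

Lemma adj_sym G : symmetric (adj G).
Proof. by move=> u v; rewrite /adj setUC. Qed.

Lemma adj_neq G u v : simpleb G -> adj G u v -> u != v.
Proof. by move=> /forall_inP h /h; rewrite cards2; case: (u != v). Qed.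

Lemma edge_adj G e u :
  simpleb G -> e \in G -> u \in e -> exists2 v, e = [set u; v] & adj G u v.
Proof.
move=> /forall_inP h eG ue; have /cards2P[p [q [_ epq]]] := h _ eG.
move: ue eG; rewrite epq !inE => /orP[] /eqP-> eG; first by exists q.
by exists p; rewrite // /adj setUC.
Qed.

Definition star G v : graph n := [set e in G | v \in e].

Definition nbrs G v := [set u | adj G v u].

Lemma pair_inj v : injective (fun u => [set v; u]).
Proof.
move=> u w /= h.
have : u \in [set v; w] by rewrite -h !inE eqxx orbT.
have : w \in [set v; u] by rewrite h !inE eqxx orbT.
by rewrite !inE => /orP[/eqP wv|/eqP->//] /orP[/eqP uv|/eqP//]; rewrite uv wv.
Qed.

Lemma star_nbrs G v : simpleb G -> star G v = [set [set v; u] | u in nbrs G v].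
Proof.
move=> sG; apply/setP=> e; rewrite inE; apply/andP/imsetP.
  by case=> eG /(edge_adj sG eG)[u -> au]; exists u; rewrite ?inE.
by case=> u; rewrite inE => au ->; rewrite !inE eqxx.
Qed.

Lemma card_nbrs G v : simpleb G -> #|nbrs G v| = degree G v.
Proof.
move=> sG; rewrite -[degree G v]/#|star G v| star_nbrs // card_imset //.
exact: pair_inj.
Qed.

Lemma degreeE G v : degree G v = \sum_(e in G) (v \in e).
Proof.
rewrite /degree -sum1_card; under eq_bigl do rewrite inE.
by rewrite big_mkcondr; apply: eq_bigr => e _; case: (v \in e).
Qed.

Lemma degree_gt0 G v : (0 < degree G v) = (v \in cover G).
Proof.
rewrite card_gt0; apply/set0Pn/bigcupP.
  by case=> e; rewrite inE => /andP[]; exists e.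
by case=> e eG ve; exists e; rewrite inE eG.
Qed.

Lemma degree_sub F G v : F \subset G -> degree F v <= degree G v.
Proof.
by move=> sFG; apply/subset_leq_card/subsetP=> e; rewrite !inE => /andP[/(subsetP sFG)->].
Qed.

Lemma degreeD F G v : F \subset G -> degree (G :\: F) v = degree G v - degree F v.
Proof.
move=> sFG; rewrite !degreeE (big_setID F (A := G)) /= (setIidPr sFG).
by rewrite addKn.
Qed.

Lemma handshake G : simpleb G -> \sum_v degree G v = 2 * #|G|.
Proof.
move=> /forall_inP sG; under eq_bigr do rewrite degreeE.
rewrite exchange_big; transitivity (\sum_(e in G) 2); last first.
  by rewrite sum_nat_const mulnC.
apply: eq_bigr => e /sG /eqP <-.
by rewrite -sum1_card [RHS]big_mkcond; apply: eq_bigr => v _; case: (v \in e).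
Qed.

Lemma cover_sub F G : F \subset G -> cover F \subset cover G.
Proof.
move=> sFG; apply/bigcupsP=> e eF; apply: (bigcup_sup e) => //.
exact: (subsetP sFG).
Qed.

Lemma handshake_cover G : simpleb G -> \sum_(v in cover G) degree G v = 2 * #|G|.
Proof.
move=> sG; rewrite -handshake // [RHS](bigID [in cover G]) /=.
by rewrite [X in _ + X]big1 ?addn0 // => v; rewrite -degree_gt0 lt0n negbK => /eqP.
Qed.

(** Every covered vertex has degree at least 2, while the handshake identity gives an average of at
    most 2 over the covered vertices. So the total excess over 2 vanishes. *)
Lemma degree_le2 G :
  simpleb G -> #|G| <= #|cover G| -> (forall v, degree G v != 1) ->
  forall v, degree G v <= 2.
Proof.
move=> sG le1 d1 v.
have [vc|] := boolP (v \in cover G); last first.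
  by rewrite -degree_gt0 lt0n negbK => /eqP->.
have e2 : \sum_(u in cover G) (degree G u - 2) + 2 * #|cover G| = 2 * #|G|.
  rewrite -handshake_cover // mulnC -sum_nat_const -big_split /=.
  apply: eq_bigr => u; rewrite -degree_gt0 => du; rewrite subnK //.
  by case: (degree G u) du (d1 u) => [|[|]].
have: \sum_(u in cover G) (degree G u - 2) == 0 by card_lia.
by rewrite sum_nat_eq0 => /forall_inP /(_ v vc).
Qed.

(** * Sparse graphs and tight sets *)

Definition induced G S : graph n := [set e in G | e \subset S].

Definition sparse G := [forall S : {set 'I_n}, #|induced G S| <= #|S|].

Lemma sparseP G : reflect (forall S, #|induced G S| <= #|S|) (sparse G).
Proof. exact: forallP. Qed.

Lemma inducedS F G S T :
  F \subset G -> S \subset T -> induced F S \subset induced G T.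
Proof.
move=> sFG sST; apply/subsetP=> e; rewrite !inE => /andP[/(subsetP sFG)-> /=].
by move=> /subset_trans; apply.
Qed.

Lemma sparse_sub F G : F \subset G -> sparse G -> sparse F.
Proof.
move=> sFG /sparseP sG; apply/sparseP=> S; apply: leq_trans (sG S).
exact/subset_leq_card/inducedS.
Qed.

Lemma sub_induced_cover F G : F \subset G -> F \subset induced G (cover F).
Proof.
move=> sFG; apply/subsetP=> e eF; rewrite inE (subsetP sFG) //=.
exact: (bigcup_sup e).
Qed.

Lemma sparse_cover F G : sparse G -> F \subset G -> #|F| <= #|cover F|.
Proof.
move=> /sparseP sG sFG; apply: leq_trans (sG _).
exact/subset_leq_card/sub_induced_cover.
Qed.

(** Apply the handshake identity to the edges inside [S]: the degrees they produce are at most 2 and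
    live on vertices of [S]. *)
Lemma degree_le2_sparse G :
  simpleb G -> (forall v, degree G v <= 2) -> sparse G.
Proof.
move=> sG d2; apply/sparseP=> S.
have sI : induced G S \subset G by apply/subsetP=> e; rewrite inE => /andP[].
have cI : cover (induced G S) \subset S.
  by apply/bigcupsP=> e; rewrite inE => /andP[].
apply: leq_trans (subset_leq_card cI).
rewrite -(leq_pmul2l (isT : 0 < 2)) -handshake_cover ?(simple_sub sI) //.
rewrite [2 * _]mulnC -sum_nat_const; apply: leq_sum => v _.
exact: leq_trans (degree_sub _ sI) (d2 v).
Qed.

(** In a sparse graph this is an equality: [S] has no room for a further edge. *)
Definition tight G S := #|S| <= #|induced G S|.

(** The edges inside [T] already use up the allowance of [T], so sparsity of [T :|: S] leaves at
    most [#|S|] for the new edges. *)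
Lemma tight_ext G T S F :
  sparse G -> tight G T -> F \subset induced G (T :|: S) ->
  [disjoint F & induced G T] -> #|F| <= #|S|.
Proof.
move=> /sparseP sG tT sF dF.
have : #|F :|: induced G T| <= #|T :|: S|.
  apply: leq_trans (sG _); apply: subset_leq_card.
  by rewrite subUset sF inducedS // subsetUl.
rewrite cardsU disjoint_setI0 // cards0 subn0.
move: tT; rewrite /tight; have := (leq_card_setU T S).1; card_lia.
Qed.

(** The number of spanned edges is supermodular and the number of vertices is modular; sparsity
    bounds the edges inside [S :&: T], so the union receives the rest. *)
Lemma tightU G S T : sparse G -> tight G S -> tight G T -> tight G (S :|: T).
Proof.
move=> /sparseP sG; rewrite /tight => tS tT.
have h1 : #|induced G S :|: induced G T| <= #|induced G (S :|: T)|.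
  by apply: subset_leq_card; rewrite subUset !inducedS ?subsetUl ?subsetUr.
have h2 : #|induced G S :&: induced G T| <= #|induced G (S :&: T)|.
  apply: subset_leq_card; apply/subsetP=> e; rewrite !inE subsetI.
  by case/andP=> /andP[-> ->] /andP[_ ->].
have := sG (S :&: T); have := cardsUI S T.
have := cardsUI (induced G S) (induced G T); card_lia.
Qed.

(** * Sparse graphs and pseudoforests *)

(** [F'] consists of the edges inside the component of [u]. No edge leaves a component, so the two
    parts cover disjoint vertex sets. *)
Lemma split_components F u v :
  simpleb F -> u \in cover F -> v \in cover F -> ~~ connect (adj F) u v ->
  exists F', [/\ F' \proper F, F' != set0 &
    #|cover F'| + #|cover (F :\: F')| <= #|cover F|].
Proof.
move=> sF uF vF nc; pose C := [set w | connect (adj F) u w].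
have eC e w : e \in F -> w \in e -> w \in C -> e \subset C.
  move=> eF we wC; have [w' -> a] := edge_adj sF eF we.
  rewrite subUset !sub1set wC inE; apply: connect_trans (connect1 a).
  by rewrite inE in wC.
have sI : induced F C \subset F by apply/subsetP=> e; rewrite inE => /andP[].
exists (induced F C); split.
- rewrite properE sI; apply/subsetPn; case/bigcupP: vF => e eF ve.
  exists e => //; rewrite inE eF /=; apply/subsetPn; exists v => //.
  by rewrite inE.
- case/bigcupP: uF => e eF ue; apply/set0Pn; exists e; rewrite inE eF /=.
  by apply: eC ue _ => //; rewrite inE.
rewrite -(cardsID C (cover F)); apply: leq_add; apply: subset_leq_card.
  rewrite subsetI cover_sub //.
  by apply/bigcupsP=> e; rewrite inE => /andP[].
apply/bigcupsP=> e; rewrite !inE => /andP[+ eF]; rewrite eF /= => neC.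
apply/subsetP=> w we; rewrite inE; apply/andP; split.
  by apply: contra neC; apply: eC.
by apply/bigcupP; exists e.
Qed.

(** [k] is the required excess of edges over covered vertices: excess 0 produces one cycle, excess 1
    a second cycle in the same component. *)
Definition dense k F := (F != set0) && (k + #|cover F| <= #|F|).

(** A disconnected [F] splits into two nonempty parts that by minimality have excess at most [k - 1]
    each. Then [F] has excess at most [2k - 2], which is below [k] when [k < 2]. *)
Lemma minset_dense_connected k F :
  k < 2 -> simpleb F -> minset (dense k) F ->
  forall u v, u \in cover F -> v \in cover F -> connect (adj F) u v.
Proof.
move=> k2 sF /minsetP[/andP[_ dF] mF] u v uF vF; apply/negPn/negP => nc.
have [F' [pF' F'0 cF']] := split_components sF uF vF nc.
have [sF' neF'] := (proper_sub pF', proper_neq pF').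
have sD : F :\: F' \subset F by exact: subsetDl.
have D0 : F :\: F' != set0.
  by rewrite setD_eq0; move: pF'; rewrite properE => /andP[].
have neD : F :\: F' != F.
  apply: contra F'0 => /eqP h; rewrite -subset0 -(setDv F').
  by apply/subsetP=> e eF'; move: (subsetP sF' _ eF'); rewrite -h inE eF'.
have ndense X : X \subset F -> X != set0 -> X != F -> #|X| < k + #|cover X|.
  move=> sX X0 neX; rewrite ltnNge; apply: contra neX => dX.
  by apply/eqP/mF => //; rewrite /dense X0.
have := ndense _ sF' F'0 neF'; have := ndense _ sD D0 neD.
have := cardsID F' F; rewrite (setIidPr sF'); card_lia.
Qed.

(** A minimal dense subset [C] is a cycle. It has no more edges than covered vertices, since losing
    one edge destroys density. It has no vertex of degree 1, since deleting a pendant edge also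
    uncovers a vertex and so keeps density. Hence [degree_le2] applies. *)
Lemma dense_cycle F :
  simpleb F -> dense 0 F -> exists2 C, is_cycle F C & C \subset F.
Proof.
move=> sF dF; have [C mC sCF] := minset_exists dF.
have [/andP[C0 dC] minC] := minsetP mC.
have sC := simple_sub sCF sF.
(* With density this gives [C] two edges, so [C :\ e] is nonempty and minimality can be applied to
   it. *)
have big_cover : 1 < #|cover C|.
  have /set0Pn[e eC] := C0; have /forall_inP/(_ e eC)/eqP <- := sC.
  exact/subset_leq_card/(bigcup_sup e).
have del e : e \in C -> #|C :\ e| < #|cover (C :\ e)|.
  move=> eC; rewrite ltnNge; apply/negP => le.
  suff /setP/(_ e) : C :\ e = C by rewrite !inE eqxx eC.
  apply: minC (subD1set _ _); rewrite /dense le andbT -card_gt0.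
  by have := cardsD1 e C; rewrite eC; card_lia.
have leC : #|C| <= #|cover C|.
  have /set0Pn[e eC] := C0; have := del e eC; have := cardsD1 e C.
  have := subset_leq_card (cover_sub (subD1set C e)); rewrite eC; card_lia.
have d1 v : degree C v != 1.
  apply/eqP => d1; have /cards1P[e he] : #|[set e in C | v \in e]| == 1 by apply/eqP.
  have /setP/(_ e) := he; rewrite !inE eqxx => /andP[eC ve].
  have := del e eC; have := cardsD1 e C; rewrite eC.
  have vC : v \in cover C by apply/bigcupP; exists e.
  have : cover (C :\ e) \subset cover C :\ v.
    rewrite subsetD1 cover_sub ?subD1set //=; apply/bigcupP => -[f].
    rewrite !inE => /andP[nfe fC] vf; have /setP/(_ f) := he.
    by rewrite !inE fC vf (negPf nfe).
  move=> /subset_leq_card; have := cardsD1 v (cover C); rewrite vC; card_lia.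
exists C => //; split=> //.
  move=> v; have := degree_le2 sC leC d1 v; have := d1 v; card_lia.
move=> u v; rewrite !degree_gt0; exact: minset_dense_connected mC _ _.
Qed.

Lemma connect_adj_sub F G u v :
  F \subset G -> connect (adj F) u v -> connect (adj G) u v.
Proof.
move=> /subsetP sFG; apply: connect_sub => p q a; apply: connect1.
exact: sFG.
Qed.

Lemma is_cycle_sub F G C : F \subset G -> is_cycle F C -> is_cycle G C.
Proof. by move=> sFG [sC C0 dC cC]; split=> //; apply: subset_trans sFG. Qed.

(** An overfull set yields a minimal edge set [F] of excess 1, which is connected. It contains a
    cycle [C1]; deleting an edge [e] of [C1] leaves excess 0, hence a cycle [C2] avoiding [e]. Both
    lie in one component of [G]. *)
Lemma pseudoforest_sparse G : simpleb G -> pseudoforest G -> sparse G.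
Proof.
move=> sG pG; apply/negPn/negP; rewrite negb_forall => /existsP[S].
rewrite -ltnNge => dS.
have sI : induced G S \subset G by apply/subsetP=> e; rewrite inE => /andP[].
have dI : dense 1 (induced G S).
  rewrite /dense -card_gt0 (leq_ltn_trans _ dS) //= add1n.
  apply: leq_ltn_trans dS; apply: subset_leq_card.
  by apply/bigcupsP=> e; rewrite inE => /andP[].
have [F mF sFI] := minset_exists dI.
have sFG := subset_trans sFI sI; have sF := simple_sub sFG sG.
have [/andP[F0 dF] _] := minsetP mF.
have [|C1 cC1 sC1] := dense_cycle sF; first by rewrite /dense F0 ltnW.
have [_ /set0Pn[e eC1] _ _] := cC1; have eF := subsetP sC1 _ eC1.
have sD := subD1set F e.
have [||C2 cC2 sC2] := @dense_cycle (F :\ e).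
- exact: simple_sub sF.
- have := cardsD1 e F; rewrite eF => cF.
  have cov1 : 0 < #|cover F|.
    apply: leq_trans (subset_leq_card (bigcup_sup e eF)).
    by have /forall_inP/(_ e eF)/eqP-> := sF.
  have := subset_leq_card (cover_sub sD).
  rewrite /dense -card_gt0 => le; apply/andP; split; card_lia.
have [_ /set0Pn[f fC2] _ _] := cC2.
have memc (C : graph n) g : g \in C -> C \subset F -> exists2 u, u \in cover C & u \in cover F.
  move=> gC sCF; have gF := subsetP sCF _ gC.
  have /card_gt0P[u ug] : 0 < #|g| by have /forall_inP/(_ g gF)/eqP-> := sF.
  by exists u; apply/bigcupP; exists g.
have [u1 u1C u1F] := memc _ _ eC1 sC1.
have sC2F := subset_trans sC2 sD.
have [u2 u2C u2F] := memc _ _ fC2 sC2F.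
suff h : C1 = C2 by move: (subsetP sC2 e); rewrite -h eC1 !inE eqxx => /(_ isT).
apply: (pG C1 C2 u1 u2); rewrite ?degree_gt0 //.
- exact: is_cycle_sub cC1.
- exact: is_cycle_sub (subset_trans sD sFG) cC2.
- apply: connect_adj_sub sFG _; exact: minset_dense_connected mF _ _ u1F u2F.
Qed.

Lemma cycle_card G C : simpleb G -> is_cycle G C -> #|C| = #|cover C|.
Proof.
move=> sG [sCG _ dC _]; apply/eqP; rewrite -(eqn_pmul2l (isT : 0 < 2)).
rewrite -handshake_cover ?(simple_sub sCG) //.
rewrite [2 * _]mulnC -sum_nat_const; apply/eqP/eq_bigr => v.
by rewrite -degree_gt0; case: (dC v) => ->.
Qed.

Lemma cycle_cover_tight G C : simpleb G -> is_cycle G C -> tight G (cover C).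
Proof.
move=> sG cC; have [sCG _ _ _] := cC; rewrite /tight -(cycle_card sG cC).
exact/subset_leq_card/sub_induced_cover.
Qed.

Lemma connect_closed_set (r : rel 'I_n) S u v :
  (forall p q, r p q -> p \in S -> q \in S) ->
  connect r u v -> u \in S -> v \in S.
Proof.
move=> cl /connectP[p pp ->]; elim: p u pp => //= q p IH u /andP[ruq pq] uS.
exact: IH pq (cl _ _ ruq uS).
Qed.

(* If every common vertex had degree 2 in C1 :&: C2, both cycles would leave the
   common vertex set closed, and connectedness would force C1 = C2. *)
Lemma cycle_sub_of_full G C1 C2 u :
  simpleb G -> is_cycle G C1 -> is_cycle G C2 ->
  u \in cover C1 :&: cover C2 ->
  (forall v, v \in cover C1 :&: cover C2 -> degree (C1 :&: C2) v = 2) ->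
  C1 \subset C2.
Proof.
move=> sG [s1 _ d1 k1] [s2 _ d2 k2] uI full.
have st v : v \in cover C1 :&: cover C2 -> star C1 v \subset C2.
  move=> vI; have dv := full v vI.
  have sI : [set e in C1 :&: C2 | v \in e] \subset star C1 v.
    by apply/subsetP=> e; rewrite !inE => /andP[/andP[-> _] ->].
  have /eqP <- : [set e in C1 :&: C2 | v \in e] == star C1 v.
    rewrite eqEcard sI -[X in _ <= X]/(degree (C1 :&: C2) v) dv.
    by rewrite -[X in X <= _]/(degree C1 v); case: (d1 v) => ->.
  by apply/subsetP=> e; rewrite !inE => /andP[/andP[]].
have sC1 := simple_sub s1 sG.
have all v : v \in cover C1 -> v \in cover C1 :&: cover C2.
  move=> v1; have u1 : u \in cover C1 by move: uI; rewrite inE => /andP[].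
  apply: (connect_closed_set _ (k1 u v _ _) uI); rewrite ?degree_gt0 //.
  move=> p q a pI; have e2 : [set p; q] \in C2.
    by apply: (subsetP (st p pI)); rewrite inE -/(adj C1 p q) a !inE eqxx.
  by rewrite inE; apply/andP; split; apply/bigcupP; exists [set p; q];
    rewrite // !inE eqxx orbT.
apply/subsetP=> e e1.
have /card_gt0P[v ve] : 0 < #|e| by have /forall_inP/(_ e e1)/eqP-> := sC1.
have v1 : v \in cover C1 by apply/bigcupP; exists e.
by apply: (subsetP (st v (all v v1))); rewrite inE e1.
Qed.

(** A cycle has as many edges as vertices. Sparsity of the union and inclusion-exclusion then give
    at least as many common edges as common vertices. Common degrees are at most 2, so all of them
    equal 2 and [cycle_sub_of_full] applies both ways. *)
Lemma sparse_meeting_cycles G C1 C2 u :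
  simpleb G -> sparse G -> is_cycle G C1 -> is_cycle G C2 ->
  u \in cover C1 :&: cover C2 -> C1 = C2.
Proof.
move=> sG /sparseP spG c1 c2 uI.
have [s1 _ d1 k1] := c1; have [s2 _ d2 k2] := c2.
set V := cover C1 :&: cover C2.
have le : #|V| <= #|C1 :&: C2|.
  have := cycle_card sG c1; have := cycle_card sG c2.
  have := cardsUI C1 C2; have := cardsUI (cover C1) (cover C2).
  have : #|C1 :|: C2| <= #|cover C1 :|: cover C2|.
    apply: leq_trans (spG _); apply: subset_leq_card; rewrite subUset.
    rewrite (subset_trans (sub_induced_cover s1)) ?inducedS ?subsetUl //=.
    by rewrite (subset_trans (sub_induced_cover s2)) ?inducedS ?subsetUr.
  rewrite -/V; card_lia.
have sI : simpleb (C1 :&: C2).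
  by apply: simple_sub sG; apply: subset_trans s1; apply: subsetIl.
have dle v : degree (C1 :&: C2) v <= 2.
  apply: leq_trans (degree_sub _ (subsetIl _ _)) _; by case: (d1 v) => ->.
have cV : cover (C1 :&: C2) \subset V.
  by rewrite subsetI !cover_sub ?subsetIl ?subsetIr.
have eI : \sum_(v in V) degree (C1 :&: C2) v = 2 * #|C1 :&: C2|.
  rewrite -handshake // [RHS](bigID [in V]) /= [X in _ + X]big1 ?addn0 // => v vV.
  apply/eqP; rewrite -leqn0 leqNgt degree_gt0; apply: contra vV.
  exact: (subsetP cV).
have eS : \sum_(v in V) (2 - degree (C1 :&: C2) v) + 2 * #|C1 :&: C2| = 2 * #|V|.
  rewrite -eI -big_split mulnC -sum_nat_const; apply: eq_bigr => v _.
  by rewrite /= subnK.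
have /eqP : \sum_(v in V) (2 - degree (C1 :&: C2) v) = 0 by card_lia.
rewrite sum_nat_eq0 => /forall_inP full.
have dV v : v \in V -> degree (C1 :&: C2) v = 2.
  move=> /full; have := dle v; card_lia.
apply/eqP; rewrite eqEsubset (cycle_sub_of_full sG c1 c2 uI) //=.
by apply: (cycle_sub_of_full (u := u) sG c2 c1); rewrite setIC // [C2 :&: C1]setIC.
Qed.

(** For disjoint cycles, grow the vertex set of [C1] to a maximal tight set [T] disjoint from [C2].
    No edge leaves [T], so [T] contains the whole component of [u], including the vertex [v] of
    [C2]: a contradiction. *)
Lemma sparse_pseudoforest G : simpleb G -> sparse G -> pseudoforest G.
Proof.
move=> sG spG C1 C2 u v c1 c2; rewrite !degree_gt0 => u1 v2 cuv.
have [d12|/pred0Pn[w /andP[w1 w2]]] := boolP [disjoint cover C1 & cover C2]; last first.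
  by apply: (sparse_meeting_cycles sG spG c1 c2 (u := w)); rewrite inE; apply/andP.
pose p S := [&& cover C1 \subset S, tight G S & [disjoint S & cover C2]].
have p1 : p (cover C1) by rewrite /p subxx cycle_cover_tight.
have [T mT _] := maxset_exists p1.
have [/and3P[T1 tT dT] maxT] := maxsetP mT.
have vT : v \in T.
  apply: (connect_closed_set _ cuv (subsetP T1 _ u1)) => a b ab aT.
  apply/negPn/negP => bT.
  have nT F : (forall e, e \in F -> ~~ (e \subset T)) -> [disjoint F & induced G T].
    move=> h; rewrite disjoint_subset; apply/subsetP=> e /h.
    by rewrite !inE negb_and => ->; rewrite orbT.
  have nabT : ~~ ([set a; b] \subset T) by rewrite subUset !sub1set (negPf bT) andbF.
  (* If [b] lies on [C2], then [C2] together with the edge [ab] adds one edge too many to [T]. *)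
  have [b2|b2] := boolP (b \in cover C2).
    have [sC2 _ _ _] := c2.
    have ab2 : [set a; b] \notin C2.
      apply/negP => h; have a2 : a \in cover C2.
        by apply/bigcupP; exists [set a; b]; rewrite // !inE eqxx.
      by have := disjointFr dT aT; rewrite a2.
    have : #|[set a; b] |: C2| <= #|cover C2|.
      apply: (tight_ext spG tT).
        rewrite subUset sub1set inE -andbA; apply/and3P; split=> //.
          by rewrite subUset !sub1set !inE aT b2 orbT.
        apply: subset_trans (sub_induced_cover sC2) _.
        by rewrite inducedS // subsetUr.
      apply: nT => e; rewrite !inE => /orP[/eqP->//|e2].
      apply/negP => eT; have /card_gt0P[c ce] : 0 < #|e|.
        by have /forall_inP/(_ e (subsetP sC2 _ e2))/eqP-> := sG.
      have := disjointFr dT (subsetP eT _ ce).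
      by have -> : c \in cover C2 by apply/bigcupP; exists e.
    by rewrite cardsU1 ab2 (cycle_card sG c2) add1n ltnn.
  (* Otherwise the edge [ab] pays for the new vertex [b], and [T] was not maximal. *)
  have : b |: T = T; last by move/setP/(_ b); rewrite !inE eqxx (negPf bT).
  apply: maxT (subsetUr _ _); rewrite /p (subset_trans T1) ?subsetUr //=.
  rewrite disjoints_subset subUset sub1set inE b2 -disjoints_subset dT !andbT.
  rewrite /tight cardsU1 bT add1n.
  apply: leq_ltn_trans tT _; apply: proper_card; rewrite properE.
  rewrite inducedS ?subsetUr //=; apply/subsetPn; exists [set a; b].
    by rewrite inE subUset !sub1set !inE eqxx aT orbT andbT.
  by rewrite inE negb_and nabT orbT.
by have := disjointFr dT vT; rewrite v2.
Qed.

(** * Switches *)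

Definition interb (A : sw n) G :=
  let: (a, b, c, d) := A in
  [&& [set a; b] \in G, [set c; d] \in G, [disjoint [set a; b] & [set c; d]],
      [set a; c] \notin G & [set b; d] \notin G].

Lemma interbP A G : reflect (interchangeable A G) (interb A G).
Proof. by case: A => [[[a b] c] d]; apply: and5P. Qed.

Lemma disjoint_pairs a b c d :
  [disjoint [set a; b] & [set c; d]] = [&& a != c, a != d, b != c & b != d].
Proof.
by rewrite disjoints_subset subUset !sub1set !inE !negb_or -!andbA.
Qed.

Lemma interb_neq a b c d G : simpleb G -> interb (a, b, c, d) G ->
  [/\ a != b, c != d, a != c & a != d] /\ (b != c) && (b != d).
Proof.
move=> sG /and5P[ab cd]; rewrite disjoint_pairs => /and4P[-> -> -> ->] _ _.
by rewrite (adj_neq sG ab) (adj_neq sG cd).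
Qed.

Lemma tauE a b c d G : interb (a, b, c, d) G ->
  tau (a, b, c, d) G = [set a; c] |: ([set b; d] |: (G :\ [set a; b] :\ [set c; d])).
Proof.
move=> iA; rewrite /tau -[X in if X then _ else _]/(interb (a, b, c, d) G) iA.
by rewrite setUC setUA.
Qed.

Lemma tau_id A G : ~~ interb A G -> tau A G = G.
Proof.
case: A => [[[a b] c] d] /negPf nA.
by rewrite /tau -[X in if X then _ else _]/(interb (a, b, c, d) G) nA.
Qed.

Lemma pair_eq u v w : ([set u; v] == [set u; w]) = (v == w).
Proof. exact: inj_eq (@pair_inj u) v w. Qed.

Lemma pair_neq u v S : u \notin S -> ([set u; v] == S) = false.
Proof. by move=> uS; apply: contraNF uS => /eqP <-; rewrite !inE eqxx. Qed.

Lemma tau_simple A G : simpleb G -> simpleb (tau A G).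
Proof.
case: A => [[[a b] c] d] sG.
have [iA|nA] := boolP (interb (a, b, c, d) G); last by rewrite tau_id.
have [[_ _ ac _] /andP[_ bd]] := interb_neq sG iA.
rewrite (tauE iA); apply/forall_inP => e; rewrite !inE => /or3P[/eqP->|/eqP->|].
- by rewrite cards2 ac.
- by rewrite cards2 bd.
by case/and3P=> _ _; have /forall_inP := sG; apply.
Qed.

Lemma degreeU1 e G v : e \notin G -> degree (e |: G) v = (v \in e) + degree G v.
Proof. by move=> eG; rewrite !degreeE big_setU1. Qed.

Lemma tau_degree A G v : simpleb G -> degree (tau A G) v = degree G v.
Proof.
case: A => [[[a b] c] d] sG.
have [iA|nA] := boolP (interb (a, b, c, d) G); last by rewrite tau_id.
have [[ab cd ac ad] /andP[bc bd]] := interb_neq sG iA.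
have [abG cdG _ acG bdG] := and5P iA.
(* Both graphs are [K] plus two edges, and each pair of edges covers [a], [b], [c], [d] once. *)
set K := G :\ [set a; b] :\ [set c; d].
have eG : G = [set a; b] |: ([set c; d] |: K).
  by rewrite setD1K ?setD1K // !inE eq_sym cdG pair_neq // !inE negb_or ac ad.
have n1 : [set b; d] \notin K by rewrite !inE (negPf bdG) !andbF.
have n2 : [set a; c] \notin [set b; d] |: K.
  by rewrite !inE (negPf acG) !andbF orbF pair_neq // !inE negb_or ab ad.
have n3 : [set c; d] \notin K by rewrite !inE eqxx.
have n4 : [set a; b] \notin [set c; d] |: K.
  by rewrite !inE eqxx !andbF orbF pair_neq // !inE negb_or ac ad.
rewrite (tauE iA) -/K eG !degreeU1 // !inE.
have [->|_] := eqVneq v a; first by rewrite (negPf ab) (negPf ac) (negPf ad).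
have [->|_] := eqVneq v b; first by rewrite (negPf bc) (negPf bd).
by have [->|_] := eqVneq v c; first by rewrite (negPf cd).
Qed.

(** Transposing the matrix reverses the switch; this is what makes [step] symmetric. *)
Lemma tau_inv a b c d G : simpleb G -> interb (a, b, c, d) G ->
  let G' := tau (a, b, c, d) G in
  interb (a, c, b, d) G' /\ tau (a, c, b, d) G' = G.
Proof.
move=> sG iA G'; have [[ab cd ac ad] /andP[bc bd]] := interb_neq sG iA.
have [abG cdG _ acG bdG] := and5P iA.
have iA' : interb (a, c, b, d) G'.
  rewrite /interb /G' (tauE iA) disjoint_pairs; apply/and5P; split.
  - by rewrite !inE eqxx.
  - by rewrite !inE eqxx orbT.
  - by rewrite ab ad cd eq_sym bc.
  - by rewrite !inE eqxx pair_eq (negPf bc) pair_neq ?andbF // !inE negb_or ab ad.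
  have n1 : ([set c; d] == [set a; c]) = false.
    by rewrite [X in _ == X]setUC pair_eq eq_sym (negPf ad).
  have n2 : ([set c; d] == [set b; d]) = false.
    by rewrite pair_neq // !inE negb_or eq_sym bc cd.
  by rewrite !inE eqxx n1 n2.
split=> //; rewrite (tauE iA') /G' (tauE iA); apply/setP=> e; rewrite !inE.
have [->|_] := eqVneq e [set a; b]; first by rewrite abG.
have [->|_] := eqVneq e [set c; d]; first by rewrite cdG.
have [->|_] := eqVneq e [set a; c]; first by rewrite (negPf acG) !andbF.
by have [->|_] := eqVneq e [set b; d]; first by rewrite (negPf bdG) !andbF.
Qed.

Lemma nbrs_tau v x y z G : simpleb G -> interb (v, y, x, z) G ->
  nbrs (tau (v, y, x, z) G) v = x |: nbrs G v :\ y.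
Proof.
move=> sG iA; have [[vy xz vx vz] /andP[yx yz]] := interb_neq sG iA.
apply/setP=> u; rewrite !inE {1}/adj (tauE iA) !inE !pair_eq.
by rewrite !pair_neq // !inE negb_or ?vy ?vx ?vz.
Qed.

(** The predicate [P] lets one argument serve both all simple graphs and sparse graphs. Requiring it
    at both ends keeps whole paths inside [P]. *)
Definition step (P : pred (graph n)) : rel (graph n) := fun X Y =>
  [&& simpleb X, P X, P Y & [exists A, interb A X && (Y == tau A X)]].

Lemma step_tau (P : pred (graph n)) A X :
  simpleb X -> P X -> interb A X -> P (tau A X) -> step P X (tau A X).
Proof.
by move=> sX pX iA pY; apply/and4P; split=> //; apply/existsP; exists A; rewrite iA /=.
Qed.

Lemma step_sym P : symmetric (step P).
Proof.
suff imp X Y : step P X Y -> step P Y X by move=> X Y; apply/idP/idP; apply: imp.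
case/and4P=> sX pX pY /existsP[[[[a b] c] d] /andP[iA /eqP eY]].
have [iA' eX] := tau_inv sX iA; rewrite eY -{2}eX; apply: step_tau => //.
- exact: tau_simple.
- by rewrite -eY.
by rewrite eX.
Qed.

Lemma connect_step_sym P : connect_sym (step P).
Proof. exact/sym_connect_sym/step_sym. Qed.

Definition realizes (P : pred (graph n)) (s : 'I_n -> nat) G :=
  [/\ simpleb G, P G & forall v, degree G v = s v].

Lemma step_realizes (P : pred (graph n)) (s : 'I_n -> nat) X Y :
  step P X Y -> realizes P s X -> realizes P s Y.
Proof.
case/and4P=> sX pX pY /existsP[A /andP[iA /eqP eY]] [_ _ dX]; split=> //.
  by rewrite eY tau_simple.
by move=> v; rewrite eY tau_degree.
Qed.

Lemma realizesW (P : pred (graph n)) (s : 'I_n -> nat) X :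
  realizes P s X -> realizes predT s X.
Proof. by case. Qed.

(** Switches preserve degrees, so [f] has to respect steps only between realizations of [s]. *)
Lemma connect_step_map (P P' : pred (graph n)) (f : graph n -> graph n) s X Y :
  (forall X Y, realizes P s X -> step P X Y -> step P' (f X) (f Y)) ->
  realizes P s X -> connect (step P) X Y -> connect (step P') (f X) (f Y).
Proof.
move=> fS rX /connectP[p pp ->]; elim: p X rX pp => [|Z p IH] X rX /=.
  by rewrite connect0.
case/andP=> XZ pp; apply: connect_trans (connect1 (fS _ _ rX XZ)) _.
exact: IH (step_realizes XZ rX) pp.
Qed.

(** * Moving one edge at a vertex *)

(** The candidates [z] for trading [vy], [xz] against [vx], [yz]. Deleting [y] and [x] on the two
    sides keeps the formula symmetric for counting. *)
Definition private G x y := (nbrs G x :\ y) :\: (nbrs G y :\ x).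

Lemma in_private G x y w : simpleb G ->
  (w \in private G x y) = [&& adj G x w, w != y & ~~ adj G y w].
Proof.
move=> sG; rewrite !inE.
have [->|wx] /= := eqVneq w x; last by rewrite andbC [_ && adj _ _ _]andbC -andbA.
by case axx : (adj G x x) => //=; [have := adj_neq sG axx; rewrite eqxx|rewrite andbF].
Qed.

(** The two neighborhoods share their common part, and a possible edge [xy] counts once in each; the
    rest differ in size exactly as the degrees do. *)
Lemma private_le G x y :
  simpleb G -> degree G y <= degree G x -> #|private G y x| <= #|private G x y|.
Proof.
move=> sG; rewrite -!card_nbrs // (cardsD1 x (nbrs G y)) (cardsD1 y (nbrs G x)) !inE.
rewrite (adj_sym G y x) leq_add2l -(cardsID (nbrs G x :\ y) (nbrs G y :\ x)).
by rewrite -(cardsID (nbrs G y :\ x) (nbrs G x :\ y)) setIC leq_add2l.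
Qed.

Lemma self_private G v x y :
  simpleb G -> adj G v y -> ~~ adj G v x -> x != v -> v \in private G y x.
Proof.
by move=> sG vy vx xv; rewrite in_private // adj_sym vy eq_sym xv adj_sym.
Qed.

Lemma private_interb G v x y z : simpleb G -> adj G v y -> ~~ adj G v x ->
  x != v -> z \in private G x y -> interb (v, y, x, z) G.
Proof.
move=> sG vy vx xv; rewrite in_private // => /and3P[xz zy yz].
apply/and5P; split=> //; rewrite disjoint_pairs.
rewrite eq_sym xv ![_ == z]eq_sym zy andbT /=; apply/andP; split.
  by apply: contraNneq vx => <-; rewrite adj_sym.
by apply: contraNneq vx => <-.
Qed.

(** The Havel-Hakimi exchange at [v] carried out inside [P]; the condition [s y <= s x] is what
    provides a candidate [z]. *)
Definition movable (P : pred (graph n)) (s : 'I_n -> nat) v := forall G x y,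
  realizes P s G -> adj G v y -> ~~ adj G v x -> x != v -> s y <= s x ->
  exists2 z, interb (v, y, x, z) G & P (tau (v, y, x, z) G).

(** Since [v] is private to [y], the degree condition gives [x] a private neighbor as well. *)
Lemma movable_predT s v : movable predT s v.
Proof.
move=> G x y [sG _ dG] vy vx xv; rewrite -!dG => /(private_le sG) le.
have /card_gt0P[z zp] : 0 < #|private G x y|.
  apply: leq_trans le; apply/card_gt0P; exists v; exact: self_private.
by exists z => //; apply: private_interb zp.
Qed.

(** Allows the edges at a deleted vertex [v] to be put back without leaving [P]. *)
Definition liftable (P : pred (graph n)) v k := forall X F,
  P X -> degree X v = 0 -> (forall e, e \in F -> v \in e) -> #|F| = k -> P (X :|: F).

(** A set [S] that spans the new edge contains [v], and its old edges all lie in [S :\ v], so there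
    are at most [#|S| - 1] of them. *)
Lemma liftable_sparse v : liftable sparse v 1.
Proof.
move=> X F /sparseP pX dX vF /eqP/cards1P[f eF]; apply/sparseP=> S.
have vX e : e \in X -> v \notin e.
  move=> eX; apply/negP=> ve; have : v \in cover X by apply/bigcupP; exists e.
  by rewrite -degree_gt0 dX.
have vf : v \in f by apply: vF; rewrite eF inE.
have [fS|fS] := boolP (f \subset S).
  have vS := subsetP fS _ vf.
  have : #|induced (X :|: F) S| <= #|f |: induced X (S :\ v)|.
    apply: subset_leq_card; apply/subsetP=> e; rewrite eF !inE subsetD1.
    case/andP=> /orP[eX|/eqP->] eS; last by rewrite eqxx.
    by rewrite eX eS vX ?orbT.
  have := pX (S :\ v); have := cardsD1 v S; rewrite vS.
  have := cardsU1 f (induced X (S :\ v)); case: (f \notin _); card_lia.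
apply: leq_trans (pX S); apply: subset_leq_card; apply/subsetP=> e.
rewrite eF !inE => /andP[/orP[->|/eqP->] eS] //.
by rewrite eS in fS.
Qed.

(** Adding the single vertex [x] to a tight set leaves room for only one edge. *)
Lemma tight_two_nbrs G T x p q : sparse G -> tight G T -> x \notin T ->
  p \in T -> q \in T -> p != q -> adj G x p -> adj G x q -> False.
Proof.
move=> pG tT xT pT qT pq xp xq.
have : #|[set [set x; p]; [set x; q]]| <= #|[set x]|.
  apply: (tight_ext pG tT).
    rewrite subUset !sub1set !inE -/(adj G x p) -/(adj G x q) xp xq.
    by rewrite !subUset !sub1set !inE eqxx pT qT !orbT.
  rewrite disjoint_subset; apply/subsetP=> e.
  rewrite !inE negb_and => /orP[]/eqP->; rewrite subUset sub1set (negPf xT) orbT //.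
by rewrite cards1 cards2 pair_eq pq.
Qed.

(** An overfull set [T] after the switch must span the new edge [yz], the only one gained away from
    [v]. Before the switch [T] was therefore just tight. *)
Lemma nonsparse_switch G v x y z : simpleb G -> sparse G -> degree G v = 1 ->
  interb (v, y, x, z) G -> ~~ sparse (tau (v, y, x, z) G) ->
  exists T, [/\ tight (G :\ [set v; y]) T, y \in T, z \in T & x \notin T].
Proof.
move=> sG pG dv iA; have [[vy xz vx vz] /andP[yx yz]] := interb_neq sG iA.
have [vyG xzG _ vxG yzG] := and5P iA.
have dt : degree (tau (v, y, x, z) G) v = 1 by rewrite tau_degree.
set G' := G :\ [set v; y].
have pG' : sparse G' by apply: sparse_sub pG; apply: subD1set.
move: dt; rewrite (tauE iA) -/G'; set K := _ |: (G' :\ _).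
have vxK : [set v; x] \notin K.
  by rewrite !inE (negPf vxG) !andbF orbF pair_neq // !inE negb_or vy vz.
rewrite degreeU1 // !inE eqxx => -[dK] nK.
(* Hanging the leaf [v] on a sparse graph keeps it sparse, so the violation already occurs in
   [K]. *)
have : ~~ sparse K.
  apply: contra nK => pK; rewrite setUC; apply: (liftable_sparse pK dK).
    by move=> e; rewrite inE => /eqP->; rewrite !inE eqxx.
  by rewrite cards1.
rewrite negb_forall => /existsP[T]; rewrite -ltnNge => ltT.
have leG' := sparseP _ pG' T.
have yzT : [set y; z] \subset T.
  apply/negPn/negP => nT; have : #|induced K T| <= #|induced G' T|.
    apply: subset_leq_card; apply/subsetP=> e; rewrite [e \in _]inE.
    case/andP=> + eT; rewrite !inE eT andbT => /orP[/eqP ee|/and3P[_ -> ->] //].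
    by rewrite -ee eT in nT.
  card_lia.
have [yT zT] : y \in T /\ z \in T.
  by move: yzT; rewrite subUset !sub1set => /andP.
exists T; split=> //.
  have : #|induced K T| <= #|[set y; z] |: induced G' T|.
    apply: subset_leq_card; apply/subsetP=> e; rewrite [e \in _]inE.
    by case/andP=> + eT; rewrite !inE eT andbT => /orP[->//|/and3P[_ -> ->]]; rewrite orbT.
  rewrite /tight cardsU1; case: (_ \notin _); card_lia.
(* With [x] in [T] the switch would also remove [xz] from inside [T], with no net gain. *)
apply/negP => xT.
have xzI : [set x; z] \in induced G' T.
  rewrite !inE xzG subUset !sub1set xT zT !andbT eq_sym pair_neq //.
  by rewrite !inE negb_or vx vz.
have : #|induced K T| <= #|[set y; z] |: (induced G' T :\ [set x; z])|.
  apply: subset_leq_card; apply/subsetP=> e; rewrite [e \in _]inE.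
  by case/andP=> + eT; rewrite !inE eT andbT => /orP[->//|/and3P[-> -> ->]]; rewrite orbT.
have := cardsD1 [set x; z] (induced G' T); rewrite xzI.
rewrite cardsU1; case: (_ \notin _); card_lia.
Qed.

(* The tight sets obstructing the switches for the various z all contain y and
   avoid x, so by tightU they merge into one, which can absorb only one
   neighbor of x.  Hence a single z is obstructed; if it is the only candidate,
   then y has degree 1 and a tight set cannot contain y once v is deleted. *)
Lemma movable_sparse s v : s v = 1 -> movable sparse s v.
Proof.
move=> sv G x y [sG pG dG] vy vx xv; rewrite -!dG => /(private_le sG) le.
have vp := self_private sG vy vx xv.
have [/existsP[z /andP[zp pz]]|] :=
    boolP [exists z, (z \in private G x y) && sparse (tau (v, y, x, z) G)].
  by exists z => //; apply: private_interb zp.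
rewrite negb_exists => /forallP bad; exfalso.
set G' := G :\ [set v; y].
have pG' : sparse G' by apply: sparse_sub pG; apply: subD1set.
have obstr z : z \in private G x y ->
    exists T, [/\ tight G' T, y \in T, z \in T & x \notin T].
  move=> zp; apply: nonsparse_switch => //; first by rewrite dG.
    exact: private_interb zp.
  by have := bad z; rewrite zp.
have adjG' a b : adj G a b -> a != v -> b != v -> adj G' a b.
  move=> ab av bv; rewrite /adj !inE -/(adj G a b) ab andbT eq_sym pair_neq //.
  by rewrite !inE negb_or ![v == _]eq_sym av bv.
have xy : x != y by apply: contraNneq vx => ->.
have pxv w : adj G x w -> w != v.
  by move=> xw; apply: contraNneq vx => <-; rewrite adj_sym.
have /card_gt0P[z zp] : 0 < #|private G x y|.
  by apply: leq_trans le; apply/card_gt0P; exists v.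
have [T [tT yT zT xT]] := obstr z zp.
have := zp; rewrite in_private // => /and3P[xz zy yz].
have xz' := adjG' _ _ xz xv (pxv _ xz).
have [/existsP[w /andP[wz wp]]|] := boolP [exists w, (w != z) && (w \in private G x y)].
  have [T' [tT' yT' wT' xT']] := obstr w wp.
  have := wp; rewrite in_private // => /and3P[xw _ _].
  apply: (tight_two_nbrs (x := x) (p := z) (q := w) pG' (tightU pG' tT tT')) => //.
  - by rewrite inE negb_or xT.
  - by rewrite inE zT.
  - by rewrite inE wT' orbT.
  - by rewrite eq_sym.
  exact: adjG' (pxv _ xw).
rewrite negb_exists => /forallP only.
have c1 : #|private G x y| <= 1.
  rewrite -(cards1 z); apply: subset_leq_card; apply/subsetP=> w wp.
  by have := only w; rewrite wp andbT negbK inE.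
have yiso w : adj G y w -> w = v.
  move=> yw; apply/eqP/negPn/negP => wv.
  (* [v] alone fills [private G y x], so another neighbor [w] of [y] is [x] or a neighbor of [x]. *)
  have wnp : w \notin private G y x.
    apply/negP=> wp; have : #|[set v; w]| <= #|private G y x|.
      by apply: subset_leq_card; rewrite subUset !sub1set vp wp.
    by rewrite cards2 eq_sym wv => /leq_trans /(_ (leq_trans le c1)).
  have [wx|wx] := eqVneq w x.
    apply: (tight_two_nbrs pG' tT xT zT yT zy xz'); apply: adjG' => //.
      by rewrite adj_sym -wx.
    by rewrite eq_sym (adj_neq sG vy).
  have xw : adj G x w by move: wnp; rewrite in_private // yw wx /= negbK.
  have xw' := adjG' _ _ xw xv wv.
  have zw : z != w by apply: contraNneq yz => ->.
  have [wT|wT] := boolP (w \in T).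
    exact: (tight_two_nbrs pG' tT xT zT wT zw xz' xw').
  have yw' : adj G' y w.
    by apply: adjG' => //; rewrite eq_sym (adj_neq sG vy).
  (* Adding the two vertices [x] and [w] to [T] would bring the three edges [xz], [xw], [yw]. *)
  have : #|[set x; z] |: [set [set x; w]; [set y; w]]| <= #|[set x; w]|.
    apply: (tight_ext pG' tT).
      rewrite !subUset !sub1set ![_ \in induced _ _]inE -/(adj G' x z).
      rewrite -/(adj G' x w) -/(adj G' y w) xz' xw' yw'.
      by rewrite !subUset !sub1set !inE !eqxx zT yT !orbT.
    rewrite disjoint_subset; apply/subsetP=> e; rewrite !inE negb_and.
    by case/or3P=> /eqP->; rewrite subUset !sub1set ?(negPf xT) ?(negPf wT) ?andbF orbT.
  have xyw : x \notin [set y; w] by rewrite !inE negb_or xy eq_sym wx.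
  rewrite cardsU1 !inE !cards2 pair_eq (negPf zw) !pair_neq //=.
  by rewrite eq_sym (negPf wx).
have : #|induced G' T| <= #|induced G' (T :\ y)|.
  apply: subset_leq_card; apply/subsetP=> e; rewrite !inE subsetD1.
  case/andP=> /andP[nvy eG] eT; rewrite nvy eG eT /=; apply/negP=> ye.
  have [w ee yw] := edge_adj sG eG ye.
  by move: nvy; rewrite ee (yiso w yw) setUC eqxx.
have := sparseP _ pG' (T :\ y); have := cardsD1 y T; rewrite yT.
move: tT; rewrite /tight; card_lia.
Qed.

(** Take a neighbor [y] of [v] only in [G] and a neighbor [x] only in [H]. If [s y <= s x], replace
    [y] by [x] in [G], otherwise [x] by [y] in [H]. Either way [y] leaves the difference, on whose
    size the induction runs. *)
Lemma align_nbrs (P : pred (graph n)) s v G H :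
  movable P s v -> realizes P s G -> realizes P s H ->
  exists G' H', [/\ realizes P s G', realizes P s H', connect (step P) G G',
    connect (step P) H H' & nbrs G' v = nbrs H' v].
Proof.
move=> mv; have [m] := ubnP #|nbrs G v :\: nbrs H v|.
elim: m G H => // m IH G H lem rG rH; have [[sG pG dG] [sH pH dH]] := (rG, rH).
have eqc : #|nbrs G v| = #|nbrs H v| by rewrite !card_nbrs // dG dH.
have [d0|/set0Pn[y]] := eqVneq (nbrs G v :\: nbrs H v) set0.
  exists G, H; split=> //; apply/eqP; rewrite eqEcard eqc leqnn andbT.
  by rewrite -setD_eq0 d0.
rewrite inE => /andP[yH yG].
have /card_gt0P[x] : 0 < #|nbrs H v :\: nbrs G v|.
  rewrite (_ : #|_| = #|nbrs G v :\: nbrs H v|).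
    by apply/card_gt0P; exists y; rewrite inE yH.
  have := cardsID (nbrs H v) (nbrs G v); have := cardsID (nbrs G v) (nbrs H v).
  rewrite (setIC (nbrs G v)); card_lia.
rewrite inE => /andP[xG xH].
have ltm S : S \subset (nbrs G v :\: nbrs H v) :\ y -> #|S| < m.
  move=> /subset_leq_card; move: lem.
  rewrite (cardsD1 y (nbrs G v :\: nbrs H v)) inE yH yG; card_lia.
move: xG xH yG yH; rewrite !inE => xG xH yG yH.
have [le|/ltnW le] := leqP (s y) (s x).
  have xv : x != v by rewrite eq_sym (adj_neq sH xH).
  have [z iA pA] := mv G x y rG yG xG xv le.
  have st := step_tau sG pG iA pA.
  have [|G' [H' [rG' rH' cG cH e]]] := IH _ H _ (step_realizes st rG) rH.
    apply: ltm; rewrite (nbrs_tau sG iA); apply/subsetP=> u; rewrite !inE.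
    case/andP=> nu /orP[/eqP ux|/andP[-> ->]]; last by rewrite nu.
    by rewrite ux xH in nu.
  by exists G', H'; split=> //; apply: connect_trans (connect1 st) cG.
have yv : y != v by rewrite eq_sym (adj_neq sG yG).
have [z iA pA] := mv H y x rH xH yH yv le.
have st := step_tau sH pH iA pA.
have [|G' [H' [rG' rH' cG cH e]]] := IH G _ _ rG (step_realizes st rH).
  apply: ltm; rewrite (nbrs_tau sH iA); apply/subsetP=> u; rewrite !inE.
  rewrite negb_or negb_and negbK => /andP[/andP[-> nu] uG]; rewrite uG andbT.
  by case/orP: nu => // /eqP ux; rewrite -ux uG in xG.
by exists G', H'; split=> //; apply: connect_trans (connect1 st) cH.
Qed.

(** * Connectedness of realizations *)

(** [v] is isolated in [X], so the switch involves only edges avoiding [v], while every member of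
    [F] contains [v]. *)
Lemma interbU A X F v : interb A X -> simpleb X -> degree X v = 0 ->
  (forall e, e \in F -> v \in e) ->
  interb A (X :|: F) /\ tau A (X :|: F) = tau A X :|: F.
Proof.
case: A => [[[a b] c] d] iA sX dX vF.
have [abX cdX dj acX bdX] := and5P iA.
have vX e : e \in X -> v \notin e.
  move=> eX; apply/negP=> ve; have : v \in cover X by apply/bigcupP; exists e.
  by rewrite -degree_gt0 dX.
have nF e : v \notin e -> e \notin F by apply: contra; apply: vF.
have := vX _ abX; rewrite !inE negb_or => /andP[va vb].
have := vX _ cdX; rewrite !inE negb_or => /andP[vc vd].
have iA' : interb (a, b, c, d) (X :|: F).
  apply/and5P; rewrite !inE abX cdX; split=> //.
    by rewrite negb_or acX nF // !inE negb_or va.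
  by rewrite negb_or bdX nF // !inE negb_or vb.
split=> //; rewrite (tauE iA') (tauE iA) -!setUA; do 2 congr (_ |: _).
apply/setP=> e; rewrite !inE; have [eF|] := boolP (e \in F); last by rewrite !orbF.
rewrite !orbT !andbT; apply/andP; split; apply: contraTneq eF => ->; apply: nF.
  by rewrite !inE negb_or vc.
by rewrite !inE negb_or va.
Qed.

(** As [s v = 0], the vertex [v] stays isolated along the path, so [interbU] applies to every
    step. *)
Lemma connect_liftU (P : pred (graph n)) (s : 'I_n -> nat) v F X Y :
  simpleb F -> (forall e, e \in F -> v \in e) -> s v = 0 -> liftable P v #|F| ->
  realizes P s X -> connect (step P) X Y ->
  connect (step P) (X :|: F) (Y :|: F).
Proof.
move=> sF vF sv lP; apply: connect_step_map (fun Z => Z :|: F) _ _ _ _ => {}X {}Y.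
move=> rX st; have [sX pX dX] := rX; have [_ pY dY] := step_realizes st rX.
have [_ _ _ /existsP[A /andP[iA /eqP eY]]] := and4P st.
have [|iA' eA'] := interbU iA sX _ vF; first by rewrite dX.
rewrite eY -eA'; apply: step_tau => //; first exact: simpleU.
  by apply: lP => //; rewrite dX.
by rewrite eA' -eY; apply: lP => //; rewrite dY.
Qed.

(** Once aligned, both graphs have the same star at [v]. Remove it, join the remainders by induction
    on the degree sum, and put the star back along the whole path. *)
Lemma connect_delete_vertex (P : pred (graph n)) s v G H :
  movable P s v -> liftable P v (s v) -> 0 < s v ->
  (forall X Y, X \subset Y -> P Y -> P X) ->
  (forall s' X Y, \sum_u s' u < \sum_u s u -> realizes P s' X -> realizes P s' Y ->
    connect (step P) X Y) ->
  realizes P s G -> realizes P s H -> connect (step P) G H.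
Proof.
move=> mv lP sv Psub IH rG rH.
have [G' [H' [[sG pG dG] [sH pH dH] cG cH e]]] := align_nbrs mv rG rH.
apply: connect_trans cG _; rewrite connect_step_sym in cH; apply: connect_trans cH.
have stE : star G' v = star H' v by rewrite !star_nbrs // e.
set F := star G' v.
have sFG : F \subset G' by apply/subsetP=> f; rewrite inE => /andP[].
have sFH : F \subset H' by rewrite /F stE; apply/subsetP=> f; rewrite inE => /andP[].
have cF : #|F| = s v by rewrite -dG.
have vF f : f \in F -> v \in f by rewrite inE => /andP[].
have dF : degree F v = s v.
  rewrite /degree -cF; apply: eq_card => f; rewrite [LHS]inE.
  by have [/vF->|] := boolP (f \in F).
pose s' u := s u - degree F u.
have real X : F \subset X -> simpleb X -> P X -> (forall u, degree X u = s u) ->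
    realizes P s' (X :\: F).
  move=> sFX sX pX dX; have sD := subsetDl X F.
  split; [exact: simple_sub sX|exact: Psub pX|].
  by move=> u; rewrite degreeD // dX.
rewrite -(setID G' F) -(setID H' F) (setIidPr sFG) (setIidPr sFH).
rewrite ![F :|: _]setUC; apply: (connect_liftU (s := s') (v := v)) => //.
- exact: simple_sub sG.
- by rewrite /s' dF subnn.
- by rewrite cF.
- exact: real.
apply: IH (real _ _ _ _ _) (real _ _ _ _ _) => //.
rewrite (bigD1 v) // [X in _ < X](bigD1 v) //= /s' dF subnn -addSn.
by apply: leq_add => //; apply: leq_sum => u _; apply: leq_subr.
Qed.

Lemma connect_realizations s G H :
  realizes predT s G -> realizes predT s H -> connect (step predT) G H.
Proof.
have [m] := ubnP (\sum_v s v); elim: m s G H => // m IH s G H lem rG rH.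
have [/existsP[v sv]|] := boolP [exists v, 0 < s v].
  apply: (@connect_delete_vertex predT s v) => //; first exact: movable_predT.
  move=> s' X Y lt; apply: IH; exact: leq_trans lt lem.
rewrite negb_exists => /forallP s0.
(* If all degrees are zero, the only realization is the empty graph. *)
suff e0 X : realizes predT s X -> X = set0 by rewrite (e0 G) // (e0 H).
case=> sX _ dX; apply/eqP/negPn/negP => /set0Pn[e eX].
have /card_gt0P[v ve] : 0 < #|e| by have /forall_inP/(_ e eX)/eqP-> := sX.
by have := s0 v; rewrite -dX degree_gt0 => /bigcupP[]; exists e.
Qed.

Lemma connect_sparse_realizations s G H :
  realizes sparse s G -> realizes sparse s H -> connect (step sparse) G H.
Proof.
have [m] := ubnP (\sum_v s v); elim: m s G H => // m IH s G H lem rG rH.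
have [/existsP[v /eqP sv]|] := boolP [exists v, s v == 1].
  apply: (@connect_delete_vertex sparse s v) => //.
  - exact: movable_sparse.
  - by rewrite sv; apply: liftable_sparse.
  - by rewrite sv.
  - exact: sparse_sub.
  by move=> s' X Y lt; apply: IH; apply: leq_trans lt lem.
rewrite negb_exists => /forallP s1.
have [sG pG dG] := rG.
have s2 v : s v <= 2.
  rewrite -dG; apply: degree_le2 => // [|u]; last by rewrite dG.
  exact: (sparse_cover pG (subxx G)).
(* All realizations are sparse here, so an unrestricted path of switches is already a sparse one. *)
have spX X : realizes predT s X -> sparse X.
  by case=> sX _ dX; apply: degree_le2_sparse => // v; rewrite dX.
apply: (connect_step_map (P := predT) (f := id) _ (realizesW rG)).
  move=> X Y rX st; have [sX _ _ eY] := and4P st.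
  by apply/and4P; split=> //; apply: spX => //; apply: step_realizes st rX.
exact: connect_realizations (realizesW rG) (realizesW rH).
Qed.

(** * From paths of sparse graphs to chains of p-switches *)

Lemma connect_pswitch_chain G H : simpleb G -> connect (step sparse) G H ->
  exists ts, pswitch_chain G ts H.
Proof.
move=> sG /connectP[p pp ->]; elim: p G sG pp => [|X p IH] G sG /=.
  by exists [::].
case/andP=> /and4P[_ _ pX /existsP[A /andP[/interbP iA /eqP eX]]] pp.
have sX : simpleb X by rewrite eX tau_simple.
have [ts cts] := IH X sX pp; exists (A :: ts); split; last by rewrite -eX.
by split=> //; rewrite -eX; apply: sparse_pseudoforest.
Qed.

End Graphs.

Theorem theorem5p7 (n : nat) (s : 'I_n -> nat) (G H : graph n) :
  simple_graph G -> simple_graph H ->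
  pseudoforest G -> pseudoforest H ->
  has_degseq G s -> has_degseq H s ->
  exists ts : seq (sw n), pswitch_chain G ts H.
Proof.
move=> /simpleP sG /simpleP sH pG pH dG dH; apply: connect_pswitch_chain => //.
by apply: (connect_sparse_realizations (s := s)); split=> //;
  apply: pseudoforest_sparse.
Qed.
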